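(* Let $\alpha<1$ be real and let $\lambda(z)\,|dz|$ be a conformal pseudometric on $\mathbb D'=\mathbb D\setminus\{0\}$ with curvature $\kappa_\lambda\le-4$ and a conical singularity of order $\alpha$ at $z=0$. Suppose that $$\frac{\lambda(z_n)}{\lambda_\alpha(z_n)}=1+o\left(|z_n|^{2(1-\alpha)}\right)\qquad(n\to\infty)$$ for some sequence $(z_n)$ in $\mathbb D'$ such that $z_n\to0$. Then $\lambda=\lambda_\alpha$ on $\mathbb D'$.
   Context: $\mathbb D$ is the open unit disk in $\mathbb C$ and $\mathbb D'=\mathbb D\setminus\{0\}$. A conformal pseudometric $\lambda(z)\,|dz|$ on a domain $G\subseteq\mathbb C$ is a continuous function $\lambda:G\to[0,\infty)$; it is assumed throughout to be of class $C^2$ on the open set $G_\lambda=\{z\in G:\lambda(z)>0\}$. Its Gauss curvature is $\kappa_\lambda(z)=-\Delta(\log\lambda)(z)/\lambda(z)^2$ for $z\in G_\lambda$, and ''$\kappa_\lambda\le-4$'' means $\kappa_\lambda(z)\le-4$ for all $z\in G_\lambda$. $\lambda(z)\,|dz|$ on $\mathbb D'$ has a conical singularity of order $\alpha<1$ at $z=0$ if there is a continuous function $v:\mathbb D\to\mathbb R$ such that $\log\lambda(z)=-\alpha\log|z|+v(z)$ for $z\in\mathbb D'$. For $\alpha<1$, $$\lambda_\alpha(z)=(1-\alpha)\,\frac{|z|^{-\alpha}}{1-|z|^{2(1-\alpha)}},\qquad z\in\mathbb D'.$$ *)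

(* Defs.v *)
From HB Require Import structures.
From mathcomp Require Import all_boot all_order all_algebra complex.
From mathcomp Require Import all_classical all_reals all_analysis.

Set Implicit Arguments.
Unset Strict Implicit.
Unset Printing Implicit Defensive.

Import Order.TTheory GRing.Theory Num.Theory.
Import numFieldNormedType.Exports.

Local Open Scope classical_set_scope.
Local Open Scope ring_scope.
Local Open Scope complex_scope.

(* [Rcomplex R] is [R[i]] seen as a real vector space, with the modulus
   [`|z| : R]. It is made a normed module over [R] here, so that ['D_v] below
   is the real directional derivative, not the complex derivative. *)

Lemma Rcomplex_normrZ (R : realType) (l : R) (x : Rcomplex R) :
  `|l *: x| = `|l| * `|x|.
Proof.
case: x => a b.
rewrite /GRing.scale /Num.norm /= !exprMn -mulrDr sqrtrM ?sqr_ge0//.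
by rewrite sqrtr_sqr.
Qed.

HB.instance Definition _ (R : realType) :=
  PseudoMetric.copy (Rcomplex R) (pseudoMetric_normed (Rcomplex R)).
HB.instance Definition _ (R : realType) := isPointed.Build (Rcomplex R) 0.
HB.instance Definition _ (R : realType) :=
  NormedZmod_PseudoMetric_eq.Build R (Rcomplex R) erefl.
HB.instance Definition _ (R : realType) :=
  PseudoMetricNormedZmod_Lmodule_isNormedModule.Build R (Rcomplex R)
    (@Rcomplex_normrZ R).

Section ConformalPseudometrics.
Variable R : realType.
Local Notation C := (Rcomplex R).
Implicit Types (G : set C) (f lam : C -> R) (alpha : R).

Definition disk : set C := [set z | `|z| < 1].

Definition punctured_disk : set C := [set z | z != 0 /\ `|z| < 1].

Definition dx f : C -> R := 'D_(1 : C) f.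
Definition dy f : C -> R := 'D_('i : C) f.

Definition laplacian f : C -> R := fun z => dx (dx f) z + dy (dy f) z.

(* [f] is of class C^k on [G]; meant for [G] open. *)
Fixpoint class_C (k : nat) G f : Prop :=
  {within G, continuous f} /\
  if k is k'.+1 then
    [/\ forall z, G z -> derivable f z (1 : C) /\ derivable f z ('i : C),
        class_C k' G (dx f) & class_C k' G (dy f)]
  else True.

Definition positivity_set G lam : set C := [set z | G z /\ 0 < lam z].

Definition conformal_pseudometric G lam : Prop :=
  [/\ {within G, continuous lam}, forall z, G z -> 0 <= lam z &
      class_C 2 (positivity_set G lam) lam].

Definition gauss_curvature lam : C -> R :=
  fun z => - laplacian (fun w => ln (lam w)) z / lam z ^+ 2.

Definition curvature_le G lam (c : R) : Prop :=
  forall z, positivity_set G lam z -> gauss_curvature lam z <= c.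

(* The equation for [log lam] with [v] finite forces [lam] to be positive; this
   is explicit because [ln] is 0 at 0 in the library. *)
Definition conical_singularity lam alpha : Prop :=
  exists2 v : C -> R, {within disk, continuous v} &
    forall z, punctured_disk z ->
      0 < lam z /\ ln (lam z) = - alpha * ln `|z| + v z.

Definition lambda_ alpha : C -> R := fun z =>
  (1 - alpha) * (`|z| `^ (- alpha) / (1 - `|z| `^ (2 * (1 - alpha)))).

End ConformalPseudometrics.

Arguments disk {R}.
Arguments punctured_disk {R}.

(* Main.v *)
Require Import Defs.
From mathcomp Require Import all_boot all_order all_algebra complex.
From mathcomp Require Import all_classical all_reals all_analysis.
From mathcomp Require Import ring lra.
Import Order.TTheory GRing.Theory Num.Theory.
Import numFieldNormedType.Exports.
Local Open Scope classical_set_scope.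
Local Open Scope ring_scope.

Set Implicit Arguments.
Unset Strict Implicit.
Unset Printing Implicit Defensive.

(** Write [b = 1 - alpha] and [lam z = |z|^(b-1) exp (v z)], with [v] continuous
    on the whole disk.  Since [ln |z|] is harmonic, the curvature bound becomes
    the Liouville inequality [Lap v >= 4 |z|^(2(b-1)) exp (2 v)] off the origin,
    and the quotient [lam / lambda_ alpha] becomes
    [q = exp v * (1 - |z|^(2b)) / b], which extends continuously to the origin.
    The sequence [z_n] thus says that [q 0 = 1], and the theorem is a strong
    maximum principle: [q <= 1] everywhere ([ahlfors]), and a subsolution that
    touches the extremal one at a point, here the singular point 0, coincides
    with it ([ratio_rigidity]).

    The only analytic tool is that at a local maximum the second derivatives
    along [1] and along [i] are nonpositive.  Hence a function [g] on a compact
    set is at most 1 as soon as [ln g] has a positive Laplacian wherever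
    [g > 1] ([maximum_principle]).  Multiplying [g] by [|z|^e], which kills the
    origin and adds a harmonic function to [ln g], and letting [e] tend to 0,
    gives the same statement on a disk whose centre is exempted from the
    differential inequality ([maximum_principle_punctured]).

    [ahlfors] compares [v] with the extremal solution on a slightly smaller disk,
    which is infinite on the boundary circle.  For the equality case, put
    [W = (lambda_ alpha)^2]; then [Lap (ln q) >= 4 W (q^2 - 1)], and
    [1 - 2 psi < q^2] as long as [q exp psi > 1], so that [q exp psi <= 1] holds
    for every [psi > 0] with [Lap psi >= 8 W psi] for which it holds on the
    boundary.  A Gaussian bump as [psi] shows that if [q p < 1], then [q < 1] on
    every disk centred at [p] that avoids 0 and the unit circle
    ([ratio_lt1_ball]).  Following such disks inwards and then around the origin,
    [q < 1] holds on a full circle [|z| = r].  Near 0 the weight [W] may be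
    unbounded and bumps are not available; but the linear equation
    [Lap psi = 8 W psi] has the positive radial solution
    [(1 + |z|^(2b)) / (1 - |z|^(2b))], equal to 1 at the origin, and a small
    multiple of it as [psi] yields [q 0 < 1] ([ratio_lt1_origin]), a
    contradiction. *)

(** * Second directional derivatives of real functions on a normed space *)

Section SecondDerivatives.
Context {R : realType} {V : normedModType R}.
Implicit Types (f g : V -> R) (F dF : R -> R) (z v : V).

(** A directional derivative is an ordinary derivative along a line; this is how
    the one-variable chain rule and mean value theorem are brought in. *)
Lemma is_derive_line f z v (t a : R) :
  is_derive (t *: v + z) v f a <-> is_derive t 1 (fun s : R => f (s *: v + z)) a.
Proof.
have E : (fun h : R => h^-1 *: ((f \o shift (t *: v + z)) (h *: v) - f (t *: v + z)))
  = (fun h : R => h^-1 *: (((fun s : R => f (s *: v + z)) \o shift t) (h *: 1) - f (t *: v + z))).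
  apply/funext => h /=; congr (_ *: (f _ - _)).
  by rewrite addrA -scalerDl; congr (_ *: _ + _); rewrite /GRing.scale /= mulr1.
split=> -[D V'].
- by apply: DeriveDef; [rewrite /derivable -E|rewrite /derive -E].
- by apply: DeriveDef; [rewrite /derivable E|rewrite /derive E].
Qed.

Lemma is_derive_comp f F z v (a b : R) :
  is_derive z v f a -> is_derive (f z) 1 F b -> is_derive z v (F \o f) (b * a).
Proof.
move=> fa Fb; rewrite -[z]add0r -(scale0r v).
apply/is_derive_line; apply: (@is_derive1_comp _ F (fun s : R => f (s *: v + z))).
- by rewrite scale0r add0r.
- by apply/is_derive_line; rewrite scale0r add0r.
Qed.

Lemma near_line z v (P : V -> Prop) :
  (\forall y \near z, P y) -> \forall t \near (0 : R), P (t *: v + z).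
Proof.
move=> Pz.
have : (t *: v + z) @[t --> (0 : R)] --> z.
  rewrite -[X in _ --> X]add0r -[X in _ --> X + _](scale0r v).
  by apply: cvgD; [apply: cvgZr_tmp; exact: cvg_id|exact: cvg_cst].
exact.
Qed.

(** The first derivative along [v] vanishes at [z]; a positive second derivative
    would make it positive on a short segment after [z], along which [f] would
    increase. *)
Lemma derive2_le0_at_max f z v :
  (\forall y \near z, derivable f y v) -> derivable ('D_v f) z v ->
  (\forall y \near z, f y <= f z) -> 'D_v ('D_v f) z <= 0.
Proof.
move=> df ddf fz; rewrite leNgt; apply/negP => d2.
pose g (t : R) := f (t *: v + z).
have g0 : g 0 = f z by rewrite /g scale0r add0r.
have [e /= e0 He] : \forall t \near (0 : R), derivable f (t *: v + z) v /\ g t <= g 0.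
  by rewrite g0; apply: filter_app (near_line v df); apply: filterS (near_line v fz).
have dg (t : R) : `|t| < e -> is_derive t (1 : R) g ('D_v f (t *: v + z)).
  move=> te; apply/is_derive_line; apply: derivableP.
  by have [] : derivable f (t *: v + z) v /\ g t <= g 0 by apply: He; rewrite /= sub0r normrN.
have gm (t : R) : `|t| < e -> g t <= g 0.
  move=> te; have [//] : derivable f (t *: v + z) v /\ g t <= g 0.
  by apply: He; rewrite /= sub0r normrN.
have inE' (t : R) : t \in `]-e, e[ = (`|t| < e) by rewrite in_itv /= ltr_norml.
have Df0 : 'D_v f z = 0.
  have h0 : is_derive (0 : R) 1 g 0.
    apply: (@derive1_at_max _ g (- e) e 0).
    - by rewrite -subr_ge0 opprK addr_ge0 // ltW.
    - by move=> t; rewrite inE' => /dg [].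
    - by rewrite inE' normr0.
    - by move=> t; rewrite inE'; exact: gm.
  have h1 := dg 0; rewrite normr0 scale0r add0r in h1; have {}h1 := h1 e0.
  by case: h0 => _ <-; case: h1 => _ <-.
have [d /= d0 Hd] : \forall h \near (0 : R)^',
    0 < h^-1 *: (('D_v f \o shift z) (h *: v) - 'D_v f z).
  have : h^-1 *: (('D_v f \o shift z) (h *: v) - 'D_v f z) @[h --> 0^'] -->
    'D_v ('D_v f) z by exact: ddf.
  by move=> /cvgr_gt; exact.
pose m := Num.min e d; have m0 : 0 < m by rewrite lt_min e0.
have [me md] : m <= e /\ m <= d by split; rewrite ge_min lexx ?orbT.
have [|||c] := @MVT _ g (fun t => 'D_v f (t *: v + z)) 0 (m / 2).
- by rewrite divr_gt0.
- move=> x; rewrite in_itv /= => /andP[x0 x1]; apply: dg.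
  rewrite gtr0_norm //; lra.
- apply: derivable_within_continuous => x; rewrite in_itv /= => /andP[x0 x1].
  have [] // := dg x; rewrite ger0_norm //. lra.
rewrite in_itv /= => /andP[c0 c1] gE.
have : 0 < g (m / 2) - g 0.
  rewrite gE subr0 mulr_gt0 // ?divr_gt0 //.
  have := Hd c; rewrite /= sub0r normrN gtr0_norm // Df0 subr0.
  have cd : c < d by lra.
  move=> /(_ cd); rewrite gt_eqF // => /(_ isT).
  by rewrite /GRing.scale /= pmulr_rgt0 // invr_gt0.
rewrite subr_gt0 ltNge gm // gtr0_norm ?divr_gt0//.
lra.
Qed.

(** The second derivative is only asked at [z], which is what the test at a
    maximum uses. *)
Definition twice_derivable v f z :=
  (\forall y \near z, derivable f y v) /\ derivable ('D_v f) z v.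

(** To compute a second derivative it is enough to exhibit the first one near the
    point. *)
Lemma near_is_derive2 f g z v (b : R) :
  (\forall y \near z, is_derive y v f (g y)) -> is_derive z v g b ->
  [/\ twice_derivable v f z, 'D_v f z = g z & 'D_v ('D_v f) z = b].
Proof.
move=> fg gb.
have E : \forall y \near z, g y = 'D_v f y.
  by apply: filterS fg => y [].
split.
- split; first by apply: filterS fg => y [].
  by apply: near_eq_derivable E _; case: gb.
- by rewrite (nbhs_singleton E).
- by rewrite -(near_eq_derive _ E); case: gb.
Qed.

Lemma twice_derivableD f g z v :
  twice_derivable v f z -> twice_derivable v g z ->
  twice_derivable v (f + g) z /\
  'D_v ('D_v (f + g)) z = 'D_v ('D_v f) z + 'D_v ('D_v g) z.
Proof.
move=> [f1 f2] [g1 g2].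
have [||h1 _ h2] := @near_is_derive2 (f + g) ('D_v f + 'D_v g) z v
  ('D_v ('D_v f) z + 'D_v ('D_v g) z).
- apply: filterS2 f1 g1 => y fy gy.
  exact: is_deriveD (derivableP fy) (derivableP gy).
- exact: is_deriveD (derivableP f2) (derivableP g2).
- by split; [exact: h1|exact: h2].
Qed.

Lemma twice_derivable_comp F dF (ddF : R) f z v :
  {for z, continuous f} ->
  (\forall t \near f z, is_derive (t : R) (1 : R) F (dF t)) -> is_derive (f z) 1 dF ddF ->
  twice_derivable v f z ->
  [/\ twice_derivable v (F \o f) z, 'D_v (F \o f) z = dF (f z) * 'D_v f z &
  'D_v ('D_v (F \o f)) z = ddF * 'D_v f z ^+ 2 + dF (f z) * 'D_v ('D_v f) z].
Proof.
move=> fc F1 F2 [f1 f2].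
have [||] := @near_is_derive2 (F \o f) ((dF \o f) * 'D_v f) z v
  (dF (f z) *: 'D_v ('D_v f) z + 'D_v f z *: (ddF * 'D_v f z)).
- apply: filterS2 f1 (fc _ F1) => y fy Fy.
  exact: is_derive_comp (derivableP fy) Fy.
- have fz := derivableP (nbhs_singleton f1).
  exact: is_deriveM (is_derive_comp fz F2) (derivableP f2).
move=> ? -> ->; split=> //.
by rewrite /GRing.scale /= addrC; congr (_ + _); rewrite mulrC expr2 mulrA.
Qed.

Lemma is_derive_affine f (a : R) z v :
  (forall h : R, f (h *: v + z) = h * a + f z) -> is_derive z v f a.
Proof.
move=> fa.
have E : (fun h : R => h^-1 *: ((f \o shift z) (h *: v) - f z)) @ 0^' --> a.
  have c : (fun _ : R => a) @ (0 : R)^' --> a by exact: cvg_cst.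
  apply: cvg_trans c; apply: near_eq_cvg.
  apply: filterS (@nbhs_dnbhs_neq R 0) => h h0 /=.
  by rewrite fa addrK /GRing.scale /= mulKf.
by apply: DeriveDef; [apply/cvg_ex; exists a|apply: cvg_lim].
Qed.

End SecondDerivatives.

(** * Laplacians and the maximum principle in the plane *)

Section Plane.
Context {R : realType}.
Local Notation C := (Rcomplex R).
Implicit Types (f g : C -> R) (F dF : R -> R) (c : R) (z p v : C).

Lemma normRcM (z w : C) : `|(z * w : C)| = `|z| * `|w|.
Proof. exact: Normc.normcM. Qed.

Lemma sqr_normRc z : `|z| ^+ 2 = complex.Re z ^+ 2 + complex.Im z ^+ 2.
Proof. by case: z => a b; rewrite /Num.norm /= sqr_sqrtr // addr_ge0 ?sqr_ge0. Qed.

Lemma continuous_dist p : continuous (fun z : C => `|z - p|).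
Proof.
move=> z; apply: (@continuous_comp _ _ _ (fun w : C => w - p) Num.norm);
  last exact: norm_continuous.
by apply: (@continuousB _ C C); [move=> ?; exact|exact: cst_continuous].
Qed.

Lemma continuous_within_open (A : set C) f z : (forall w, A w -> nbhs w A) ->
  {within A, continuous f} -> A z -> {for z, continuous f}.
Proof.
move=> nA; have oA : open A by rewrite openE => w Aw; exact: nA.
by rewrite continuous_open_subspace // => fA Az; apply: fA; exact: mem_set.
Qed.

(** A disk is closed in the image of a square under an affine map of the plane. *)
Lemma compact_disk p (r : R) : compact [set z | `|z - p| <= r].
Proof.
pose h (a : R * R) : C := p + (a.1 *: (1 : C) + a.2 *: ('i%C : C)).
have hc : continuous h.
  move=> a; apply: cvgD; first exact: cvg_cst.
  by apply: cvgD; apply: cvgZr_tmp; [exact: cvg_fst|exact: cvg_snd].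
apply: (@subclosed_compact _ _ (h @` (`[- r, r]%classic `*` `[- r, r]%classic))).
- apply: (@closed_comp _ _ (fun z : C => `|z - p|) [set x | x <= r]); last exact: closed_le.
  by move=> z _; exact: continuous_dist.
- apply: continuous_compact; first exact: continuous_subspaceT.
  by apply: compact_setX; exact: segment_compact.
- move=> z /= zr; exists (complex.Re (z - p), complex.Im (z - p)) => /=.
    have r0 : 0 <= r by exact: le_trans zr.
    have sq : `|z - p| ^+ 2 <= r ^+ 2 by rewrite lerXn2r ?nnegrE.
    rewrite sqr_normRc in sq.
    rewrite !in_itv /= -!ler_norml -![_ <= r](ler_pXn2r (n := 2)) ?nnegrE //.
    rewrite !real_normK ?num_real //; split; apply: le_trans sq; last by rewrite lerDr sqr_ge0.
    by rewrite lerDl sqr_ge0.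
  rewrite /h /=; case: z {zr} => a b; case: p {h hc} => c d /=.
  by rewrite /GRing.scale /=; apply/eqP; rewrite eq_complex /=; apply/andP; split; apply/eqP; lra.
Qed.

Definition grad2 f z : R := dx f z ^+ 2 + dy f z ^+ 2.

(** [G] and [L] are the squared gradient and the Laplacian: the pair of numbers
    that is needed, and suffices, to compute the Laplacian of a composition with
    a function of one real variable. *)
Definition second_order f z (G L : R) :=
  [/\ {for z, continuous f}, twice_derivable (1 : C) f z, twice_derivable ('i%C : C) f z,
      grad2 f z = G & laplacian f z = L].

Lemma second_order_comp f F dF (ddF G L : R) z :
  (\forall t \near f z, is_derive (t : R) (1 : R) F (dF t)) -> is_derive (f z) 1 dF ddF ->
  second_order f z G L ->
  second_order (F \o f) z (dF (f z) ^+ 2 * G) (ddF * G + dF (f z) * L).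
Proof.
move=> F1 F2 [fc fx fy <- <-].
have [hx dhx ddhx] := twice_derivable_comp fc F1 F2 fx.
have [hy dhy ddhy] := twice_derivable_comp fc F1 F2 fy.
split; [|exact: hx|exact: hy| |].
- apply: continuous_comp; first exact: fc.
  apply: differentiable_continuous; apply/derivable1_diffP.
  by case: (nbhs_singleton F1).
- by rewrite /grad2 /dx /dy dhx dhy; ring.
- have regroup (a a' d d' : R) : ddF * a ^+ 2 + dF (f z) * a' + (ddF * d ^+ 2 + dF (f z) * d') =
      ddF * (a ^+ 2 + d ^+ 2) + dF (f z) * (a' + d') by ring.
  exact (etrans (f_equal2 +%R ddhx ddhy) (regroup _ _ _ _)).
Qed.

Lemma second_orderD f g (G L G' L' : R) z :
  second_order f z G L -> second_order g z G' L' ->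
  second_order (f + g) z (grad2 (f + g) z) (L + L').
Proof.
move=> [fc fx fy _ <-] [gc gx gy _ <-].
have [hx ddhx] := twice_derivableD fx gx.
have [hy ddhy] := twice_derivableD fy gy.
split; [exact: (cvgD fc gc)|exact: hx|exact: hy|by []|].
exact (etrans (f_equal2 +%R ddhx ddhy) (addrACA _ _ _ _)).
Qed.

Lemma second_orderZ f c z (G L : R) : second_order f z G L ->
  second_order (fun w => c * f w) z (c ^+ 2 * G) (c * L).
Proof.
have cst0 : is_derive (f z) (1 : R) (fun _ : R => c) 0.
  exact: (is_derive_cst c (f z) (1 : R)).
have lin : \forall t \near f z, is_derive (t : R) (1 : R) (fun s => c * s) c.
  apply: filterE => t; apply: is_derive_eq (is_deriveZ c (is_derive_id t (1 : R))) _.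
  by rewrite /GRing.scale /= mulr1.
by move=> /(second_order_comp lin cst0); rewrite mul0r add0r.
Qed.

Lemma second_order_cst c z : second_order (fun _ : C => c) z 0 0.
Proof.
have D a y (u : C) : is_derive y u (fun _ : C => a) (0 : R) by exact: (is_derive_cst a y u).
have ND a (u : C) : \forall y \near z, is_derive y u (fun _ : C => a) ((fun _ : C => 0 : R) y).
  exact: (@filterE _ (nbhs z) (@nbhs_filter C z) _ (fun y => D a y u)).
have T (u : C) := near_is_derive2 (ND c u) (D 0 z u).
have [x1 x2 x3] := T (1 : C); have [y1 y2 y3] := T ('i%C : C).
split; [exact: cst_continuous|exact: x1|exact: y1| |].
- by rewrite /grad2 /dx /dy x2 y2 /= expr0n addr0.
- by rewrite /laplacian [dx (dx _) z]x3 [dy (dy _) z]y3 addr0.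
Qed.

Lemma twice_derivable_near f g z v : (\forall y \near z, f y = g y) ->
  twice_derivable v f z -> twice_derivable v g z /\ 'D_v ('D_v g) z = 'D_v ('D_v f) z.
Proof.
move=> fg [f1 f2].
have fg' := near_join fg.
have E : \forall y \near z, is_derive y v g ('D_v f y).
  apply: filterS2 f1 fg' => y fy fgy; apply: DeriveDef.
    exact: near_eq_derivable fgy fy.
  by rewrite -(near_eq_derive v fgy).
have [h1 _ h2] := near_is_derive2 E (derivableP f2).
by split; [exact: h1|exact: h2].
Qed.

Lemma second_order_near f g (G L : R) z : (\forall y \near z, f y = g y) ->
  second_order f z G L -> second_order g z G L.
Proof.
move=> fg [fc fx fy <- <-].
have [gx ddgx] := twice_derivable_near fg fx.
have [gy ddgy] := twice_derivable_near fg fy.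
split; [|exact: gx|exact: gy| |].
- change (g x @[x --> z] --> g z); rewrite -(nbhs_singleton fg).
  exact: cvg_trans (near_eq_cvg fg) fc.
- by rewrite /grad2 /dx /dy !(near_eq_derive _ fg).
- exact (f_equal2 +%R ddgx ddgy).
Qed.

(** If the maximum of [g] exceeded 1, it would be a local maximum of [ln g] at an
    interior point where the Laplacian is positive, against the second
    derivative test. *)
Lemma maximum_principle (K : set C) g : compact K ->
  (forall z, K z -> {for z, continuous g}) ->
  (forall z, K z -> 1 < g z -> nbhs z K /\
     exists G L, second_order (fun w => ln (g w)) z G L /\ 0 < L) ->
  forall z, K z -> g z <= 1.
Proof.
move=> cK gc gK z Kz.
have [|||m /set_mem Km mmax] := @compact_EVT_max _ _ g K.
- by exists z.
- by [].
- by apply: continuous_in_subspaceT => w /set_mem; exact: gc.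
apply: (le_trans (mmax z (mem_set Kz))); rewrite leNgt; apply/negP => gm.
have [nK [G [L [[lc lx ly _ lapE] L0]]]] := gK _ Km gm.
have lmax : \forall w \near m, ln (g w) <= ln (g m).
  have gpos : \forall w \near m, 0 < g w.
    by apply: (cvgr_gt _ (gc _ Km)); apply: lt_trans gm.
  apply: filterS2 nK gpos => w Kw gw.
  by rewrite ler_ln ?posrE //; [exact/mmax/mem_set|apply: lt_trans gm].
have dx0 : dx (dx (fun w => ln (g w))) m <= 0 by case: lx => ? ?; exact: derive2_le0_at_max.
have dy0 : dy (dy (fun w => ln (g w))) m <= 0 by case: ly => ? ?; exact: derive2_le0_at_max.
have := lerD dx0 dy0; rewrite -/(laplacian _ _) addr0 lapE => L1.
by move: (lt_le_trans L0 L1); rewrite ltxx.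
Qed.

Lemma is_derive_Re p z v : is_derive z v (fun w => complex.Re (w - p) : R) (complex.Re v).
Proof.
apply: is_derive_affine => h; case: v z p => [a b] [c d] [e f] /=.
by rewrite addrA.
Qed.

Lemma is_derive_Im p z v : is_derive z v (fun w => complex.Im (w - p) : R) (complex.Im v).
Proof.
apply: is_derive_affine => h; case: v z p => [a b] [c d] [e f] /=.
by rewrite addrA.
Qed.

Lemma second_order_normsq p z :
  second_order (fun w => `|w - p| ^+ 2) z (4 * `|z - p| ^+ 2) 4.
Proof.
pose X w : R := complex.Re (w - p); pose Y w : R := complex.Im (w - p).
have E : (fun w : C => `|w - p| ^+ 2) = X * X + Y * Y.
  by apply/funext => w; rewrite sqr_normRc !expr2.
have D v y : is_derive y v (X * X + Y * Y)
    ((2 * complex.Re v) * X y + (2 * complex.Im v) * Y y).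
  apply: (is_derive_eq (is_deriveD (is_deriveM (is_derive_Re p y v) (is_derive_Re p y v))
                     (is_deriveM (is_derive_Im p y v) (is_derive_Im p y v)))).
  by rewrite /GRing.scale /= -/(X y) -/(Y y); ring.
have DD v y : is_derive y v
    (fun w => (2 * complex.Re v) * X w + (2 * complex.Im v) * Y w)
    (2 * complex.Re v ^+ 2 + 2 * complex.Im v ^+ 2).
  apply: (is_derive_eq (is_deriveD (is_deriveZ (2 * complex.Re v) (is_derive_Re p y v))
                     (is_deriveZ (2 * complex.Im v) (is_derive_Im p y v)))).
  by rewrite /GRing.scale /=; ring.
have ND v : \forall y \near z, is_derive y v (X * X + Y * Y)
    ((2 * complex.Re v) * X y + (2 * complex.Im v) * Y y).
  exact: (@filterE _ (nbhs z) (@nbhs_filter C z) _ (D v)).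
have T v := near_is_derive2 (ND v) (DD v z).
have [x1 x2 x3] := T (1 : C); have [y1 y2 y3] := T ('i%C : C).
rewrite E; split; [|exact: x1|exact: y1| |].
- rewrite -E; apply: (@continuous_comp _ _ _ (fun w => `|w - p|) (fun t => t ^+ 2)).
    exact: continuous_dist.
  exact: exprn_continuous.
- by rewrite sqr_normRc /grad2 /dx /dy x2 y2 /= -/(X z) -/(Y z); ring.
- by rewrite /laplacian [dx (dx _) z]x3 [dy (dy _) z]y3 /=; ring.
Qed.

End Plane.

(** * Radial and Gaussian model functions *)

Section ModelFunctions.
Context {R : realType}.
Local Notation C := (Rcomplex R).
Implicit Types (f g : C -> R) (b c t : R) (z p w : C).

Lemma is_derive_inv (F : R -> R) t (d : R) : F t != 0 ->
  is_derive (t : R) (1 : R) F d -> is_derive t (1 : R) (fun s => (F s)^-1) (- F t ^- 2 * d).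
Proof.
move=> Ft [Fd <-]; apply: DeriveDef; first exact: derivableV.
by rewrite deriveV.
Qed.

Lemma is_derive_const_sub c t : is_derive (t : R) (1 : R) (fun s => c - s) (- 1).
Proof.
apply: is_derive_eq (is_deriveB (is_derive_cst c t (1 : R)) (is_derive_id t (1 : R))) _.
by rewrite sub0r.
Qed.

Lemma is_derive_inv_sub c t : t != c ->
  is_derive (t : R) (1 : R) (fun s => (c - s)^-1) ((c - t)^-1 ^+ 2).
Proof.
move=> tc.
have ct0 : c - t != 0 by rewrite subr_eq0 eq_sym.
have d := is_derive_const_sub c t.
apply: is_derive_eq (@is_derive_inv (fun s => c - s) t _ ct0 d) _.
by rewrite mulrN1 opprK exprVn.
Qed.

(** The extremal metrics and [radial] below are expressed through [s = |w|^(2b)],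
    whose squared gradient and Laplacian are both multiples of [|w|^(2(b-1))]: the
    Laplacian of [f (s)] is [4 b^2 |w|^(2(b-1)) (s f'' + f')]. *)
Lemma second_order_pow b z : z != 0 ->
  second_order (fun w : C => `|w| `^ (2 * b)) z
    (4 * b ^+ 2 * `|z| `^ (2 * (b - 1)) * `|z| `^ (2 * b)) (4 * b ^+ 2 * `|z| `^ (2 * (b - 1))).
Proof.
move=> z0.
have E e (w : C) : `|w| `^ (2 * e) = (`|w - 0| ^+ 2) `^ e.
  by rewrite subr0 powRrM -powR_mulrn.
pose n := `|z - 0| ^+ 2.
have n0 : 0 < n by rewrite /n subr0 exprn_gt0 // normr_gt0.
have -> : (fun w : C => `|w| `^ (2 * b)) = (fun t => t `^ b) \o (fun w => `|w - 0| ^+ 2).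
  by apply/funext => w; exact: E.
have dF : \forall t \near n, is_derive (t : R) (1 : R) (fun t => t `^ b) (b * t `^ (b - 1)).
  by apply: filterS (lt_nbhsr n0) => t t0; exact: is_derive1_powR.
have ddF : is_derive n (1 : R) (fun t => b * t `^ (b - 1)) (b * ((b - 1) * n `^ (b - 1 - 1))).
  by apply: is_derive_eq (is_deriveZ b (is_derive1_powR (b - 1) n0)) _.
have := second_order_comp dF ddF (second_order_normsq 0 z).
rewrite !E -/n.
have step e : n `^ e = n `^ (e - 1) * n.
  by rewrite -{3}(powRr1 (ltW n0)) -powRD ?subrK // (lt0r_neq0 n0) implybT.
have nb := step b; have nb2 := step (b - 1).
congr second_order.
- by rewrite nb; ring.
- by rewrite nb2; ring.
Qed.

Lemma second_order_ln_norm z : z != 0 ->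
  second_order (fun w : C => ln `|w|) z (`|z| ^- 2) 0.
Proof.
move=> z0.
pose n := `|z - 0| ^+ 2.
have n0 : 0 < n by rewrite /n subr0 exprn_gt0 // normr_gt0.
have -> : (fun w : C => ln `|w|) = (fun t => 2^-1 * ln t) \o (fun w => `|w - 0| ^+ 2).
  apply/funext => w /=; rewrite subr0.
  have [->|w0] := eqVneq w 0; first by rewrite normr0 expr0n /= ln0 // mulr0.
  by rewrite lnXn ?normr_gt0 // -(mulr_natl (ln _)) mulrA mulVf ?mul1r // pnatr_eq0.
have dF : \forall t \near n, is_derive (t : R) (1 : R) (fun t => 2^-1 * ln t) (2^-1 * t^-1).
  apply: filterS (lt_nbhsr n0) => t t0.
  by apply: is_derive_eq (is_deriveZ 2^-1 (is_derive1_ln t0)) _.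
have ddF : is_derive n (1 : R) (fun t => 2^-1 * t^-1) (2^-1 * (- n ^- 2)).
  have inv := @is_derive_inv id n _ (lt0r_neq0 n0) (is_derive_id n (1 : R)).
  apply: is_derive_eq (is_deriveZ 2^-1 inv) _.
  by rewrite /GRing.scale /= mulr1.
have := second_order_comp dF ddF (second_order_normsq 0 z).
rewrite -/n; have -> : `|z| ^- 2 = n^-1 by rewrite /n subr0.
have nn0 := lt0r_neq0 n0.
by congr second_order; field.
Qed.

(** Up to a constant and a multiple of [ln |w|], this is minus the logarithm of the extremal
    metric of the disk [|w|^(2b) < c], so that its Laplacian is [-4] times the
    square of that metric. *)
Lemma second_order_ln_sub b c z : z != 0 -> `|z| `^ (2 * b) < c ->
  exists G, second_order (fun w : C => ln (c - `|w| `^ (2 * b))) z G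
    (- (4 * b ^+ 2 * `|z| `^ (2 * (b - 1)) * c / (c - `|z| `^ (2 * b)) ^+ 2)).
Proof.
move=> z0 zc; pose s := `|z| `^ (2 * b).
have dF : \forall t \near s, is_derive (t : R) (1 : R) (fun t => ln (c - t)) (- (c - t)^-1).
  apply: filterS (lt_nbhsl zc) => t tc.
  have d := is_derive_const_sub c t.
  have ct : 0 < c - t by rewrite subr_gt0.
  have h := @is_derive1_comp _ (@ln R) (fun s : R => c - s) t _ _ (is_derive1_ln ct) d.
  by rewrite mulrN1 in h; exact: h.
have ddF : is_derive s (1 : R) (fun t => - (c - t)^-1) (- ((c - s)^-1 ^+ 2)).
  by apply: is_deriveN; apply: is_derive_inv_sub; rewrite lt_eqF.
have := second_order_comp dF ddF (second_order_pow b z0).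
rewrite -/s => H; eexists; move: H; congr second_order.
have cs : c - s != 0 by rewrite subr_eq0 gt_eqF.
by field.
Qed.

(** This is [(1 + s) / (1 - s)] with [s = |w|^(2b)], in a form that is easy to
    differentiate. *)
Definition radial b (w : C) : R := 2 * (1 - `|w| `^ (2 * b))^-1 - 1.

(** [radial] solves the linearisation [Lap f = 8 W f] of the Liouville equation,
    where [W] is the square of the extremal metric of the unit disk. *)
Lemma second_order_radial b z : z != 0 -> `|z| `^ (2 * b) < 1 ->
  exists G, second_order (radial b) z G
    (8 * (b ^+ 2 * `|z| `^ (2 * (b - 1)) / (1 - `|z| `^ (2 * b)) ^+ 2) * radial b z).
Proof.
move=> z0 z1; pose s := `|z| `^ (2 * b).
have dF : \forall t \near s, is_derive (t : R) (1 : R)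
    (fun t => 2 * (1 - t)^-1 - 1) (2 * ((1 - t)^-1 ^+ 2)).
  apply: filterS (lt_nbhsl z1) => t t1.
  have t1' : t != 1 by rewrite lt_eqF.
  have inv := is_deriveZ 2 (is_derive_inv_sub t1').
  apply: is_derive_eq (is_deriveB inv (is_derive_cst (1 : R) t (1 : R))) _.
  by rewrite subr0.
have ddF : is_derive s (1 : R) (fun t => 2 * ((1 - t)^-1 ^+ 2)) (4 * ((1 - s)^-1 ^+ 3)).
  have s1 : s != 1 by rewrite lt_eqF.
  have d := is_derive_inv_sub s1.
  apply: is_derive_eq (is_deriveZ 2 (is_deriveM d d)) _.
  by rewrite /GRing.scale /=; ring.
have := second_order_comp dF ddF (second_order_pow b z0).
rewrite -/s => H; eexists; move: H; congr second_order.
rewrite /radial -/s.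
have cs : 1 - s != 0 by rewrite subr_eq0 gt_eqF.
by field.
Qed.

Lemma second_order_gauss (k e c : R) p z :
  exists G, second_order (fun w : C => e * (expR (- k * `|w - p| ^+ 2) - c)) z G
    (4 * e * expR (- k * `|z - p| ^+ 2) * (k ^+ 2 * `|z - p| ^+ 2 - k)).
Proof.
pose n := `|z - p| ^+ 2.
have d t : is_derive (t : R) (1 : R) (fun s => expR (- k * s)) (- k * expR (- k * t)).
  have h := is_deriveZ (- k) (is_derive_id t (1 : R)).
  have hc := @is_derive1_comp _ expR (fun s : R => - k * s) t _ _ (is_derive_expR (- k * t)) h.
  by rewrite /GRing.scale /= mulr1 mulrC in hc; exact: hc.
have dF : \forall t \near n, is_derive (t : R) (1 : R)
    (fun t => e * (expR (- k * t) - c)) (e * (- k * expR (- k * t))).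
  apply: filterE => t.
  apply: is_derive_eq (is_deriveZ e (is_deriveB (d t) (is_derive_cst c t (1 : R)))) _.
  by rewrite subr0.
have ddF : is_derive n (1 : R)
    (fun t => e * (- k * expR (- k * t))) (e * (- k * (- k * expR (- k * n)))).
  by apply: is_derive_eq (is_deriveZ e (is_deriveZ (- k) (d n))) _.
have := second_order_comp dF ddF (second_order_normsq p z).
rewrite -/n => H; eexists; move: H; congr second_order.
by ring.
Qed.

End ModelFunctions.

(** * Maximum principle across a puncture *)

Section Puncture.
Context {R : realType}.
Local Notation C := (Rcomplex R).
Implicit Types (f g h v : C -> R) (b c t e r : R) (z p w : C).

Lemma near_norm_lt z r : `|z| < r -> \forall w \near z, `|w| < r.
Proof. by move=> zr; apply: (cvgr_lt _ (@norm_continuous _ C z)). Qed.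

Lemma near_neq0 z : z != 0 -> \forall w \near z, w != 0.
Proof.
move=> z0; have : 0 < `|z| by rewrite normr_gt0.
move=> /(cvgr_gt _ (@norm_continuous _ C z)).
by apply: filterS => w; rewrite normr_gt0.
Qed.

Lemma continuous_norm_powR e : 0 < e -> continuous (fun w : C => `|w| `^ e).
Proof.
move=> e0; suff H (z : C) : {for z, continuous (fun w : C => `|w| `^ e)} by move=> z; exact: H.
have [->|z0] := eqVneq z 0; last first.
  have -> : e = 2 * (e / 2) by rewrite mulrC divfK.
  by have [] := second_order_pow (e / 2) z0.
apply/(@cvgrPdist_lt _ R C (nbhs (0 : C)) (nbhs_filter (0 : C))) => d d0.
have a0 : `|0 : C| < d `^ e^-1 by rewrite normr0 powR_gt0.
apply: filterS (near_norm_lt a0) => w wd.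
rewrite normr0 powR0 ?gt_eqF // sub0r normrN ger0_norm ?powR_ge0 //.
have -> : d = (d `^ e^-1) `^ e by rewrite -powRrM mulVf ?gt_eqF // powRr1 // ltW.
by apply: gt0_ltr_powR; rewrite ?nnegrE ?powR_ge0.
Qed.

Lemma powR_lt1 e t : 0 < e -> 0 <= t -> t < 1 -> t `^ e < 1.
Proof.
move=> e0 t0 t1; have := gt0_ltr_powR e0 (_ : t \in Num.nneg) (_ : 1 \in Num.nneg) t1.
by rewrite powR1 !nnegrE; apply.
Qed.

Lemma norm_powR_lt1 b z : 0 < b -> `|z| < 1 -> `|z| `^ (2 * b) < 1.
Proof. by move=> b0 z1; apply: powR_lt1 => //; rewrite mulr_gt0. Qed.

(** The maximum principle is applied to [h w * |w|^e], which is 0 at the origin;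
    its logarithm differs from [ln h] by the harmonic function [e ln |w|]. *)
Lemma maximum_principle_punctured h r : 0 < r -> r < 1 ->
  (forall z, `|z| <= r -> {for z, continuous h}) ->
  (forall z, `|z| = r -> h z <= 1) ->
  (forall z, z != 0 -> `|z| < r -> 1 < h z ->
     exists G L, second_order (fun w => ln (h w)) z G L /\ 0 < L) ->
  forall z, `|z| <= r -> h z <= 1.
Proof.
move=> r0 r1 hc hb hl.
have main e z : 0 < e -> `|z| <= r -> h z * `|z| `^ e <= 1.
  move=> e0 zr.
  apply: (@maximum_principle _ [set w : C | `|w - 0| <= r] (fun w => h w * `|w| `^ e)).
  - exact: compact_disk.
  - move=> w /=; rewrite subr0 => wr.
    exact: continuousM (hc _ wr) (@continuous_norm_powR e e0 w).
  - move=> w /=; rewrite subr0 => wr hw.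
    have w0 : w != 0.
      by apply: contraTneq hw => ->; rewrite normr0 powR0 ?gt_eqF // mulr0 ltr10.
    have p1 : `|w| `^ e <= 1.
      rewrite -(powRr0 `|w|); apply: ger_powR; last exact: ltW.
      by rewrite normr_gt0 w0 (le_trans wr (ltW r1)).
    have hw0 : 0 < h w.
      by rewrite -(pmulr_lgt0 _ (powR_gt0 e (_ : 0 < `|w|))) ?normr_gt0 //; apply: lt_trans hw.
    have hw1 : 1 < h w by apply: lt_le_trans hw _; rewrite ger_pMr.
    have wr' : `|w| < r.
      rewrite lt_neqAle wr andbT; apply: contraTneq hw1 => /hb.
      by rewrite leNgt.
    split.
      by apply: filterS (near_norm_lt wr') => y yr /=; rewrite subr0 ltW.
    have [G [L [hL L0]]] := hl w w0 wr' hw1.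
    have HG' := second_orderZ e (second_order_ln_norm w0); rewrite mulr0 in HG'.
    have HD := second_orderD hL HG'.
    eexists; eexists; split.
      apply: second_order_near HD.
      have hpos : \forall y \near w, 0 < h y by apply: (cvgr_gt _ (hc _ wr)).
      apply: filterS2 hpos (near_neq0 w0) => y hy y0 /=.
      by rewrite lnM ?posrE ?powR_gt0 ?normr_gt0 // ln_powR.
    by rewrite addr0; exact: L0.
  - by rewrite /= subr0.
have off0 z : z != 0 -> `|z| <= r -> h z <= 1.
  move=> z0 zr; rewrite leNgt; apply/negP => hz1.
  have hz0 : 0 < h z by apply: lt_trans hz1.
  (* [e] is chosen so that [|z|^e] is the inverse square root of [h z] *)
  have lz : ln `|z| < 0 by apply: ln_lt0; rewrite normr_gt0 z0 /=; apply: le_lt_trans zr r1.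
  have lh : 0 < ln (h z) by rewrite ln_gt0.
  pose e := ln (h z) / (- (2 * ln `|z|)).
  have e0 : 0 < e by apply: divr_gt0 => //; lra.
  have := main e z e0 zr.
  rewrite leNgt => /negP; apply.
  rewrite -[h z]lnK ?posrE // /powR gt_eqF ?normr_gt0 // -expRD expR_gt1.
  rewrite [X in _ + X](_ : _ = - (ln (h z) / 2)); last by rewrite /e; field; rewrite lt_eqF.
  by lra.
move=> z zr; have [z0|z0] := eqVneq z 0; last exact: off0.
rewrite leNgt z0; apply/negP => h1.
have c0 : {for (0 : C), continuous h} by apply: hc; rewrite normr0 ltW.
have near1 : \forall w \near (0 : C), 1 < h w by apply: (cvgr_gt _ c0).
have [d /= d0 Hd] := (iffLR nbhs_norm0P) near1.
pose m := Num.min d r / 2.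
have m0 : 0 < m by rewrite divr_gt0 // lt_min d0 r0.
have [md mr] : m < d /\ m < r.
  by split; apply: (@lt_le_trans _ _ (Num.min d r)); rewrite ?ge_min ?lexx ?orbT //;
    rewrite /m; move: m0; rewrite /m; lra.
have nm : `|m *: (1 : C)| = m.
  by rewrite normrZ gtr0_norm // [X in _ * X]Normc.normc1 mulr1.
have : m *: (1 : C) != 0 by rewrite -normr_gt0 nm.
move=> /off0; rewrite nm => /(_ (ltW mr)).
by rewrite leNgt Hd //= nm.
Qed.
End Puncture.

(** * The Liouville inequality and Ahlfors' lemma *)

Section Liouville.
Context {R : realType}.
Local Notation C := (Rcomplex R).
Implicit Types (f g h v : C -> R) (b c k t e r : R) (z p w : C).

(** The inequality says that [|z|^(b-1) exp v] has curvature at most [-4]. *)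
Definition liouville_subsolution b v :=
  (forall z, `|z| < 1 -> {for z, continuous v}) /\
  (forall z, z != 0 -> `|z| < 1 -> exists G L, second_order v z G L /\
     4 * `|z| `^ (2 * (b - 1)) * expR (v z) ^+ 2 <= L).

(** With [k = 1 / (b * sqrt c)] the function under the logarithm is the quotient
    of [|z|^(b-1) exp v] by the extremal metric of the disk [|w|^(2b) < c]. *)
Lemma second_order_ln_ratio b v c k z : 0 < b -> liouville_subsolution b v ->
  0 < k -> z != 0 -> `|z| < 1 -> `|z| `^ (2 * b) < c ->
  exists G L, second_order (fun w : C => ln (expR (v w) * ((c - `|w| `^ (2 * b)) * k))) z G L /\
    4 * `|z| `^ (2 * (b - 1)) * (expR (v z) ^+ 2 - b ^+ 2 * c / (c - `|z| `^ (2 * b)) ^+ 2) <= L.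
Proof.
move=> b0 [_ vL] k0 z0 z1 zc.
have [G [L [hL L0]]] := vL z z0 z1.
have [G' hL'] := second_order_ln_sub z0 zc.
have HD := second_orderD (second_orderD hL hL') (second_order_cst (ln k) z).
eexists; eexists; split.
  apply: second_order_near HD.
  have bb : 0 < 2 * b by rewrite mulr_gt0.
  have near_c : \forall w \near z, `|w| `^ (2 * b) < c.
    by apply: (cvgr_lt _ (@continuous_norm_powR _ _ bb z)).
  apply: filterS near_c => w wc.
  have cw : 0 < c - `|w| `^ (2 * b) by rewrite subr_gt0.
  rewrite lnM ?posrE ?expR_gt0 ?mulr_gt0 // lnM ?posrE // expRK.
  by rewrite addrA.
by rewrite addr0; move: L0; lra.
Qed.

(** On the disk of radius [r < 1] the quotient by the extremal metric vanishes on
    the boundary circle, and its logarithm has a positive Laplacian where it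
    exceeds 1; so it is at most 1, and [r] tends to 1. *)
Lemma ahlfors b v z : 0 < b -> liouville_subsolution b v -> `|z| < 1 ->
  expR (v z) * ((1 - `|z| `^ (2 * b)) * b^-1) <= 1.
Proof.
move=> b0 vL z1; have [vc _] := vL.
have bb : 0 < 2 * b by rewrite mulr_gt0.
have scaled r : `|z| < r -> r < 1 ->
    expR (v z) * (r `^ (2 * b) - `|z| `^ (2 * b)) <= b * r `^ b.
  move=> zr r1; have r0 : 0 < r by apply: le_lt_trans zr.
  have rb : 0 < r `^ b by rewrite powR_gt0.
  have rb2 : r `^ (2 * b) = (r `^ b) ^+ 2.
    by rewrite mulrC powRrM -powR_mulrn ?powR_ge0.
  pose k := (b * r `^ b)^-1; have k0 : 0 < k by rewrite invr_gt0 mulr_gt0.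
  have := @maximum_principle_punctured _
    (fun w : C => expR (v w) * ((r `^ (2 * b) - `|w| `^ (2 * b)) * k)) r r0 r1 _ _ _ z (ltW zr).
  have -> : expR (v z) * ((r `^ (2 * b) - `|z| `^ (2 * b)) * k) =
            expR (v z) * (r `^ (2 * b) - `|z| `^ (2 * b)) / (b * r `^ b) by rewrite mulrA.
  rewrite ler_pdivrMr ?mulr_gt0 // mul1r; apply.
  - move=> w wr; apply: continuousM.
      apply: continuous_comp; first by apply: vc; apply: le_lt_trans wr r1.
      exact: continuous_expR.
    apply: continuousM; last exact: cst_continuous.
    apply: continuousB; first exact: cst_continuous.
    exact: continuous_norm_powR.
  - by move=> w ->; rewrite subrr mul0r mulr0.
  - move=> w w0 wr hw.
    have cw : 0 < r `^ (2 * b) - `|w| `^ (2 * b).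
      rewrite ltNge; apply/negP => cw; have := lt_trans ltr01 hw.
      by rewrite ltNge mulr_ge0_le0 ?expR_ge0 // mulr_le0_ge0 // ltW.
    have wc : `|w| `^ (2 * b) < r `^ (2 * b) by rewrite -subr_gt0.
    have [G [L [hL L0]]] := second_order_ln_ratio b0 vL k0 w0 (lt_trans wr r1) wc.
    exists G, L; split=> //; apply: lt_le_trans L0.
    rewrite pmulr_rgt0 ?mulr_gt0 ?powR_gt0 ?normr_gt0 // subr_gt0.
    have hh : b * r `^ b < expR (v w) * (r `^ (2 * b) - `|w| `^ (2 * b)).
      by move: hw; rewrite /k mulrA ltr_pdivlMr ?mulr_gt0 // mul1r.
    rewrite ltr_pdivrMr ?exprn_gt0 // [in X in X < _]rb2 -!exprMn ltr_pXn2r // nnegrE ltW //.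
      by rewrite mulr_gt0.
    by rewrite mulr_gt0 ?expR_gt0.
set A := expR (v z); set s := `|z| `^ (2 * b).
have A0 : 0 < A by rewrite expR_gt0.
rewrite mulrA ler_pdivrMr // mul1r leNgt; apply/negP => H.
(* Otherwise the inequality for [r] fails when [r ^ b = 1 - d]: to first order in
   [d] the left side has lost [2 A d], less than the excess over [b]. *)
have zb1 : `|z| `^ b < 1.
  exact: powR_lt1.
pose d := Num.min ((A * (1 - s) - b) / (4 * A)) ((1 - `|z| `^ b) / 2).
have d0 : 0 < d.
  by rewrite lt_min !divr_gt0 ?mulr_gt0 // subr_gt0.
have dA : d * (4 * A) <= A * (1 - s) - b.
  by rewrite -ler_pdivlMr ?mulr_gt0 // /d ge_min lexx.
have dz : d <= (1 - `|z| `^ b) / 2 by rewrite /d ge_min lexx orbT.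
have zb0 : 0 <= `|z| `^ b by exact: powR_ge0.
have x0 : 0 < 1 - d by lra.
pose r := (1 - d) `^ b^-1.
have rE : r `^ b = 1 - d by rewrite /r -powRrM mulVf ?gt_eqF // powRr1 // ltW.
have zr : `|z| < r.
  rewrite ltNge; apply/negP => rz.
  have : r `^ b <= `|z| `^ b by apply: ge0_ler_powR => //; rewrite ?nnegrE ?powR_ge0 // ltW.
  by rewrite rE; lra.
have r1 : r < 1.
  rewrite ltNge; apply/negP => rz.
  have : 1 `^ b <= r `^ b by apply: ge0_ler_powR => //; rewrite ?nnegrE ?powR_ge0 // ltW.
  by rewrite rE powR1; lra.
have := scaled r zr r1.
rewrite -/A -/s [2 * b]mulrC powRrM powR_mulrn ?powR_ge0 // rE => HA.
have dd : 0 <= A * d ^+ 2 by rewrite mulr_ge0 ?sqr_ge0 // ltW.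
have bd : 0 < b * d by exact: mulr_gt0.
have Ad : 0 < A * d by exact: mulr_gt0.
nra.
Qed.

End Liouville.

(** * Propagation of strict inequality *)

Section Rigidity.
Context {R : realType}.
Local Notation C := (Rcomplex R).
Implicit Types (f g h v : C -> R) (b c k t e r : R) (z p w : C).

(** The quotient by [lambda_], extended continuously to the origin. *)
Definition metric_ratio b v z : R := expR (v z) * ((1 - `|z| `^ (2 * b)) * b^-1).

(** The square of [lambda_]. *)
Definition weight b z : R :=
  b ^+ 2 * `|z| `^ (2 * (b - 1)) / (1 - `|z| `^ (2 * b)) ^+ 2.

Lemma ratio_gt0 b v z : 0 < b -> `|z| < 1 -> 0 < metric_ratio b v z.
Proof.
by move=> b0 z1; rewrite !mulr_gt0 ?expR_gt0 ?invr_gt0 // subr_gt0 norm_powR_lt1.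
Qed.

Lemma weight_gt0 b z : 0 < b -> z != 0 -> `|z| < 1 -> 0 < weight b z.
Proof.
move=> b0 z0 z1; apply: divr_gt0.
  by rewrite mulr_gt0 ?exprn_gt0 ?powR_gt0 ?normr_gt0.
by rewrite exprn_gt0 // subr_gt0 norm_powR_lt1.
Qed.

Lemma continuous_ratio b v z : 0 < b -> {for z, continuous v} ->
  {for z, continuous (metric_ratio b v)}.
Proof.
move=> b0 vc; apply: continuousM.
  by apply: continuous_comp; [exact: vc|exact: continuous_expR].
apply: continuousM; last exact: cst_continuous.
apply: continuousB; first exact: cst_continuous.
by apply: continuous_norm_powR; rewrite mulr_gt0.
Qed.

Lemma continuous_weight b z : 0 < b -> z != 0 -> `|z| < 1 ->
  {for z, continuous (weight b)}.
Proof.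
move=> b0 z0 z1; apply: continuousM.
  apply: continuousM; first exact: cst_continuous.
  by have [] := second_order_pow (b - 1) z0.
have c1 : {for z, continuous (fun w : C => (1 - `|w| `^ (2 * b)) ^+ 2)}.
  apply: (@continuous_comp _ _ _ (fun w : C => 1 - `|w| `^ (2 * b)) (fun t => t ^+ 2)).
    apply: continuousB; first exact: cst_continuous.
    by apply: continuous_norm_powR; rewrite mulr_gt0.
  exact: exprn_continuous.
apply: continuousV c1.
by rewrite sqrf_eq0 subr_eq0 gt_eqF // norm_powR_lt1.
Qed.

Lemma second_order_ln_ratio1 b v z : 0 < b -> liouville_subsolution b v ->
  z != 0 -> `|z| < 1 ->
  exists G L, second_order (fun w : C => ln (metric_ratio b v w)) z G L /\
    4 * weight b z * (metric_ratio b v z ^+ 2 - 1) <= L.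
Proof.
move=> b0 vL z0 z1.
have bi : 0 < b^-1 by rewrite invr_gt0.
have [G [L [hL L0]]] := second_order_ln_ratio b0 vL bi z0 z1 (norm_powR_lt1 b0 z1).
exists G, L; split; first exact: hL.
move: L0; congr (_ <= _); rewrite /weight /metric_ratio.
have s1 : 1 - `|z| `^ (2 * b) != 0 by rewrite subr_eq0 gt_eqF // norm_powR_lt1.
have bn0 : b != 0 by rewrite gt_eqF.
by field; rewrite bn0.
Qed.

(** As [- x < ln q], this bounds [q^2 - 1] by its linearisation; it turns
    subsolutions of the linear equation into barriers for [ln q]. *)
Lemma sqr_gt_of_mul_expR (q x : R) : 1 < q * expR x -> 1 - 2 * x < q ^+ 2.
Proof.
move=> qx.
have h1 : expR (- x) < q by rewrite expRN -[ltLHS]mul1r ltr_pdivrMr ?expR_gt0.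
have h2 : expR (- x) * expR (- x) < q ^+ 2 by rewrite expr2 ltr_pM ?expR_ge0.
apply: le_lt_trans h2; rewrite -expRD; apply: le_trans (expR_ge1Dx _); lra.
Qed.

(** Strict inequality spreads from the centre of a disk.  The barrier is a small
    Gaussian bump centred at [p] and vanishing on the boundary circle; when it is
    sharp enough, its Laplacian dominates away from [p], and near [p] the strict
    inequality leaves room for it. *)
Lemma ratio_lt1_ball b v p z r : 0 < b -> liouville_subsolution b v ->
  r < `|p| -> r + `|p| < 1 -> metric_ratio b v p < 1 -> `|z - p| < r -> metric_ratio b v z < 1.
Proof.
move=> b0 vL rp rp1 qp zr; have [vc _] := vL.
pose K := [set w : C | `|w - p| <= r].
have KP w : K w -> w != 0 /\ `|w| < 1.
  rewrite /K /= => wr; split.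
    by apply: contraTneq wr => ->; rewrite sub0r normrN -ltNge.
  have := ler_normD (w - p) p; rewrite subrK => h.
  by apply: le_lt_trans h _; apply: le_lt_trans rp1; rewrite lerD2r.
have r0 : 0 < r by apply: le_lt_trans zr.
have Kp : K p by rewrite /K /= subrr normr0 ltW.
have cK : compact K by exact: compact_disk.
have [||| m /set_mem Km mmax] := @compact_EVT_max _ _ (weight b) K.
- by exists p.
- by [].
- apply: continuous_in_subspaceT => w /set_mem /KP[w0 w1].
  exact: continuous_weight.
pose M := weight b m.
have M0 : 0 < M by have [m0 m1] := KP _ Km; exact: weight_gt0.
have [p0 p1] := KP _ Kp.
have qp0 := ratio_gt0 v b0 p1.
(* [e] is half of the logarithmic gap at [p]; it bounds the height of the bump *)
pose e := - ln (metric_ratio b v p) / 2.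
have e0 : 0 < e by rewrite divr_gt0 // oppr_gt0 ln_lt0 // qp0.
have qe : metric_ratio b v p < expR (- e).
  rewrite -[ltLHS]lnK ?posrE // ltr_expR /e; move: e0; rewrite /e; lra.
have near_e : \forall w \near p, metric_ratio b v w < expR (- e).
  by apply: (cvgr_lt _ (continuous_ratio b0 (vc _ p1))).
move: near_e => /nbhs_normP[d /= d0 Hd].
(* sharp enough for [k^2 n - k > 2 M] whenever [n >= d^2] *)
pose k := (2 * M + 1) / d ^+ 2 + 1.
have d2 : 0 < d ^+ 2 by rewrite exprn_gt0.
have k1 : 1 <= k by rewrite /k lerDr divr_ge0 // ltW //; lra.
have kd : k * d ^+ 2 = 2 * M + 1 + d ^+ 2 by rewrite /k; field; rewrite gt_eqF.
pose psi w := e * (expR (- k * `|w - p| ^+ 2) - expR (- k * r ^+ 2)).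
have key w : K w -> metric_ratio b v w * expR (psi w) <= 1.
  apply: (@maximum_principle _ K (fun w => metric_ratio b v w * expR (psi w)) cK).
    move=> y Ky; have [y0 y1] := KP _ Ky.
    apply: continuousM; first by apply: continuous_ratio => //; exact: vc.
    have [G [pc _ _ _ _]] := second_order_gauss k e (expR (- k * r ^+ 2)) p y.
    by apply: continuous_comp; [exact: pc|exact: continuous_expR].
  move=> y Ky hy; have [y0 y1] := KP _ Ky.
  have qy0 := ratio_gt0 v b0 y1.
  set E := expR (- k * `|y - p| ^+ 2).
  have E0 : 0 < E by exact: expR_gt0.
  have psiE : psi y <= e * E.
    by rewrite /psi -/E ler_pM2l // gerBl expR_ge0.
  have yd : d <= `|y - p|.
    rewrite leNgt; apply/negP => yd.
    have qy : metric_ratio b v y < expR (- e) by apply: Hd; rewrite /= distrC.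
    have E1 : E <= 1.
      by rewrite /E -[leRHS]expR0 ler_expR mulNr oppr_le0 mulr_ge0 ?sqr_ge0 //; lra.
    have pe : psi y <= e by apply: le_trans psiE _; rewrite ger_pMr.
    move: hy; rewrite ltNge => /negP; apply.
    have -> : 1 = expR (- e) * expR e by rewrite -expRD addNr expR0.
    by apply: ler_pM; rewrite ?expR_ge0 ?ler_expR // ltW.
  have yr : `|y - p| < r.
    rewrite lt_neqAle; apply/andP; split; last exact: Ky.
    apply: contraTneq hy => yr; rewrite /psi yr subrr mulr0 expR0 mulr1 -leNgt.
    exact: ahlfors.
  split.
    have : \forall w \near y, `|w - p| < r.
      by apply: (cvgr_lt _ (@continuous_dist _ p y)).
    by apply: filterS => u ur; rewrite /K /= ltW.
  have [G [L [hL L0]]] := second_order_ln_ratio1 b0 vL y0 y1.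
  have [G' hL'] := second_order_gauss k e (expR (- k * r ^+ 2)) p y.
  have HD := second_orderD hL hL'.
  eexists; eexists; split.
    apply: second_order_near HD.
    apply: filterS (near_norm_lt y1) => u u1.
    by rewrite lnM ?posrE ?expR_gt0 ?ratio_gt0 // expRK.
  apply: (@lt_le_trans _ _ (4 * weight b y * (metric_ratio b v y ^+ 2 - 1) +
    4 * e * E * (k ^+ 2 * `|y - p| ^+ 2 - k))); last by rewrite lerD2r.
  have W0 := weight_gt0 b0 y0 y1.
  have WM : weight b y <= M by apply: mmax; exact: mem_set.
  have eE : 0 < e * E by rewrite mulr_gt0.
  have q2 : 1 - 2 * (e * E) < metric_ratio b v y ^+ 2.
    by apply: le_lt_trans (sqr_gt_of_mul_expR hy); lra.
  have kk : 2 * M < k ^+ 2 * `|y - p| ^+ 2 - k.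
    have : d ^+ 2 <= `|y - p| ^+ 2 by rewrite lerXn2r ?nnegrE // ltW.
    move=> dd; have : k * d ^+ 2 <= k * `|y - p| ^+ 2 by rewrite ler_pM2l //; lra.
    rewrite kd; set T := k * `|y - p| ^+ 2 => hT.
    have -> : k ^+ 2 * `|y - p| ^+ 2 - k = k * (T - 1) by rewrite /T; ring.
    nra.
  have A1 : - (8 * M * (e * E)) < 4 * weight b y * (metric_ratio b v y ^+ 2 - 1).
    move: (weight b y) (metric_ratio b v y ^+ 2) (e * E) W0 WM q2 eE => W Q2 x W0 WM q2 x0.
    have B0 : 0 < Q2 - 1 + 2 * x by lra.
    have B1 : 0 < 4 * W * (Q2 - 1 + 2 * x) by rewrite !mulr_gt0.
    have B2 : 0 <= (M - W) * x by rewrite mulr_ge0 ?subr_ge0 // ltW.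
    by lra.
  have A2 : 4 * (e * E) * (2 * M) < 4 * e * E * (k ^+ 2 * `|y - p| ^+ 2 - k).
    by rewrite -(mulrA 4 e E) ltr_pM2l // mulr_gt0.
  by apply: le_lt_trans (ltrD A1 A2); move: (e * E) => x; lra.
have := key z (ltW zr).
have psi0 : 0 < psi z.
  rewrite mulr_gt0 // subr_gt0 ltr_expR !mulNr ltrN2 ltr_pM2l; last by lra.
  by rewrite ltr_pXn2r ?nnegrE // ltW.
have z1 : `|z| < 1 by have [] := KP _ (ltW zr : K z).
move=> h; apply: lt_le_trans h.
by rewrite ltr_pMr ?expR_gt1 // ratio_gt0.
Qed.

End Rigidity.

(** * Rigidity *)

Section Conclusion.
Context {R : realType}.
Local Notation C := (Rcomplex R).
Implicit Types (f g h v : C -> R) (b c k t e r : R) (z p w : C).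

Lemma ratio_lt1_hop b v p z : 0 < b -> liouville_subsolution b v ->
  `|z - p| < `|p| -> `|z - p| + `|p| < 1 -> metric_ratio b v p < 1 -> metric_ratio b v z < 1.
Proof.
move=> b0 vL zp zp1; pose m := Num.min `|p| (1 - `|p|).
have zm : `|z - p| < m by rewrite lt_min zp ltrBrDr.
have [mp m1] : m <= `|p| /\ m <= 1 - `|p| by split; rewrite ge_min lexx ?orbT.
by move=> qp; apply: (@ratio_lt1_ball _ b v p z ((`|z - p| + m) / 2) b0 vL _ _ qp); lra.
Qed.

(** A rotation by less than a sixth of a turn moves [p] by less than [|p|]. *)
Lemma ratio_lt1_rotate b v p (u : C) : 0 < b -> liouville_subsolution b v ->
  p != 0 -> `|p| <= 1 / 2 -> `|u| = 1 -> 1 / 2 < complex.Re u ->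
  metric_ratio b v p < 1 -> metric_ratio b v (p * u) < 1.
Proof.
move=> b0 vL p0 p1 u1 Ru; apply: ratio_lt1_hop => //.
all: have -> : `|(p * u - p : C)| = `|p| * `|u - 1| by rewrite -normRcM mulrBr mulr1.
all: have p0' : 0 < `|p| by rewrite normr_gt0.
all: have ud : `|u - 1| < 1.
1,3: rewrite -(ltr_pXn2r (n := 2)) ?nnegrE // expr1n sqr_normRc.
1,2: have := sqr_normRc u; rewrite u1 expr1n; case: u {u1} Ru => x y /= Ru; nra.
- by rewrite gtr_pMr.
- by apply: (@lt_le_trans _ _ (`|p| + `|p|)); [rewrite ltrD2r gtr_pMr|lra].
Qed.

Lemma ratio_lt1_quarter b v p (s : R) : 0 < b -> liouville_subsolution b v ->
  p != 0 -> `|p| <= 1 / 2 -> s ^+ 2 = 1 ->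
  metric_ratio b v p < 1 -> metric_ratio b v (p * (Complex 0 s : C)) < 1.
Proof.
move=> b0 vL p0 p1 s1 qp.
(* two rotations with rational coordinates whose product is a quarter turn *)
pose u : C := Complex (3 / 5) (s * (4 / 5)); pose u' : C := Complex (4 / 5) (s * (3 / 5)).
have N (x : C) : complex.Re x ^+ 2 + complex.Im x ^+ 2 = 1 -> `|x| = 1.
  by rewrite -sqr_normRc => h; apply/eqP; rewrite -(pexpr_eq1 (n := 2)) // h.
have u1 : `|u| = 1 by apply: N; rewrite /= [X in _ + X]exprMn s1; lra.
have u'1 : `|u'| = 1 by apply: N; rewrite /= [X in _ + X]exprMn s1; lra.
have -> : p * (Complex 0 s : C) = (p * u) * u'.
  rewrite -mulrA; congr (_ * _); apply/eqP; rewrite eq_complex /=.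
  by rewrite expr2 in s1; apply/andP; split; apply/eqP; nra.
apply: ratio_lt1_rotate => //=; [| |lra|].
- by rewrite -normr_gt0 normRcM u1 mulr1 normr_gt0.
- by rewrite normRcM u1 mulr1.
- by apply: ratio_lt1_rotate => //=; lra.
Qed.

(** Some multiple of [z / p] by a power of [i] has real part greater than [1/2], so
    at most two quarter turns and one smaller rotation lead from [p] to [z]. *)
Lemma ratio_lt1_circle b v p z : 0 < b -> liouville_subsolution b v ->
  p != 0 -> `|p| <= 1 / 2 -> metric_ratio b v p < 1 -> `|z| = `|p| -> metric_ratio b v z < 1.
Proof.
move=> b0 vL p0 p1 qp zp.
pose u : C := p^-1 * z.
have zE : z = p * u by rewrite /u mulrA mulfV // mul1r.
have p0' : `|p| != 0 by rewrite normr_eq0.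
have u1 : `|u| = 1.
  by apply: (mulfI p0'); rewrite -normRcM -zE mulr1.
have := sqr_normRc u; rewrite u1 expr1n => uu.
have quarter s : s ^+ 2 = 1 -> 1 / 2 < s * complex.Im u -> metric_ratio b v z < 1.
  move=> s1 su; pose i : C := Complex 0 s.
  have i1 : `|i| = 1.
    by apply/eqP; rewrite -(pexpr_eq1 (n := 2)) // sqr_normRc /= expr0n add0r s1.
  pose w : C := Complex (s * complex.Im u) (- s * complex.Re u).
  have -> : z = (p * i) * w.
    rewrite zE -mulrA; congr (_ * _); rewrite /i /w; case: (u) => x y.
    apply/eqP; rewrite eq_complex /=; apply/andP; split; apply/eqP.
      by transitivity (s ^+ 2 * x); [rewrite s1 mul1r|ring].
    by transitivity (s ^+ 2 * y); [rewrite s1 mul1r|ring].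
  apply: ratio_lt1_rotate => //.
  - by rewrite -normr_gt0 normRcM i1 mulr1 normr_gt0.
  - by rewrite normRcM i1 mulr1.
  - by apply/eqP; rewrite -(pexpr_eq1 (n := 2)) // sqr_normRc /= !exprMn sqrrN s1 !mul1r addrC -uu.
  - exact: ratio_lt1_quarter.
have [Ru|Ru] := ltP (1 / 2) (complex.Re u).
  by rewrite zE; apply: ratio_lt1_rotate.
have [Iu|Iu] := ltP (1 / 2) (complex.Im u).
  by apply: (quarter 1); [rewrite expr1n|lra].
have [Iu'|Iu'] := ltP (1 / 2) (- complex.Im u).
  by apply: (quarter (-1)); [rewrite sqrrN expr1n|lra].
have Ru' : 1 / 2 < - complex.Re u by nra.
pose i : C := Complex 0 1.
have i1 : `|i| = 1.
  by apply/eqP; rewrite -(pexpr_eq1 (n := 2)) // sqr_normRc /= expr0n add0r expr1n.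
have pin (x : C) : x != 0 -> (x * i : C) != 0.
  by move=> x0; rewrite -normr_gt0 normRcM i1 mulr1 normr_gt0.
have pil (x : C) : `|x| <= 1 / 2 -> `|(x * i : C)| <= 1 / 2.
  by rewrite normRcM i1 mulr1.
have -> : z = ((p * i) * i) * (- u).
  rewrite zE -!mulrA; congr (_ * _).
  by apply/eqP; case: (u) => x y; rewrite eq_complex /=; apply/andP; split; apply/eqP; ring.
apply: ratio_lt1_rotate => //; [exact/pin/pin|exact/pil/pil|by rewrite normrN| |].
  by case: (u) Ru' => x y.
apply: ratio_lt1_quarter => //; [exact: pin|exact: pil|by rewrite expr1n|].
by apply: ratio_lt1_quarter => //; rewrite expr1n.
Qed.

(** The bound [1/2] is what makes the disk of radius [|p|] around [p] stay inside
    the unit disk.  It is reached in at most [n] steps of length [d] towards the origin. *)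
Lemma ratio_lt1_inward b v d n p : 0 < b -> liouville_subsolution b v -> 0 < d ->
  p != 0 -> `|p| <= 1 / 2 + n%:R * d -> `|p| + d < 1 -> d <= 1 / 2 ->
  metric_ratio b v p < 1 -> exists p', [/\ p' != 0, `|p'| <= 1 / 2 & metric_ratio b v p' < 1].
Proof.
move=> b0 vL d0; elim: n p => [|n IH] p p0.
  by rewrite mul0r addr0 => p1 *; exists p.
have [p1 _ _ _ qp|p1] := leP `|p| (1 / 2); first by exists p.
rewrite -(natr1 n) mulrDl => pn pd d1 qp.
pose t := 1 - d / `|p|.
have p0' : `|p| != 0 by rewrite normr_eq0.
have dp : d / `|p| * `|p| = d by rewrite divfK.
have t0 : 0 < t.
  by rewrite subr_gt0 ltr_pdivrMr ?normr_gt0 // mul1r; lra.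
have tp : `|t *: p| = `|p| - d.
  by rewrite normrZ gtr0_norm // /t mulrBl mul1r dp.
have tpp : `|t *: p - p| = d.
  rewrite -{2}(scale1r p) -scalerBl normrZ /t addrAC subrr sub0r normrN.
  by rewrite ger0_norm ?dp // divr_ge0 // ltW.
apply: (IH (t *: p)); rewrite ?tp //; [|lra|lra|].
- by rewrite -normr_gt0 tp; lra.
- by apply: ratio_lt1_hop qp; rewrite // tpp; lra.
Qed.

(** A multiple of [radial] that is at most [- ln q] on the circle is a barrier in
    the whole punctured disk, and it is still positive at the origin. *)
Lemma ratio_lt1_origin b v r : 0 < b -> liouville_subsolution b v ->
  0 < r -> r < 1 -> (forall z, `|z| = r -> metric_ratio b v z < 1) -> metric_ratio b v 0 < 1.
Proof.
move=> b0 vL r0 r1 qr; have [vc _] := vL.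
pose K := [set z : C | `|z| = r].
have cK : compact K.
  apply: (@subclosed_compact _ _ [set z : C | `|z - 0| <= r]).
  - apply: (@closed_comp _ _ (fun z : C => `|z|) [set x | x = r]); last exact: closed_eq.
    by move=> z _; exact: norm_continuous.
  - exact: compact_disk.
  - by rewrite /K => z /= zr; rewrite subr0 zr.
have Kr : K (r *: (1 : C)).
  by rewrite /K /= normrZ gtr0_norm // [X in _ * X]Normc.normc1 mulr1.
have [||| m /set_mem Km mmax] := @compact_EVT_max _ _ (metric_ratio b v) K.
- by exists (r *: (1 : C)).
- by [].
- apply: continuous_in_subspaceT => z /set_mem zr.
  by apply: continuous_ratio => //; apply: vc; rewrite zr.
have m1 : `|m| < 1 by rewrite Km.
have qm0 := ratio_gt0 v b0 m1.
have qm1 := qr _ Km.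
have rad_gt0 z : `|z| < 1 -> 0 < radial b z.
  move=> z1; have s1 := norm_powR_lt1 b0 z1; have s0 : 0 <= `|z| `^ (2 * b) by exact: powR_ge0.
  rewrite /radial subr_gt0 -ltr_pdivrMl // mulr1 ltf_pV2 ?posrE; lra.
pose e := - ln (metric_ratio b v m) / radial b m.
have e0 : 0 < e by rewrite divr_gt0 ?rad_gt0 // oppr_gt0 ln_lt0 // qm0.
have key z : `|z| <= r -> metric_ratio b v z * expR (e * radial b z) <= 1.
  apply: (@maximum_principle_punctured _
    (fun z => metric_ratio b v z * expR (e * radial b z)) r r0 r1).
  - move=> w wr; have w1 : `|w| < 1 by apply: le_lt_trans wr r1.
    apply: continuousM; first by apply: continuous_ratio => //; exact: vc.
    apply: continuous_comp; last exact: continuous_expR.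
    apply: continuousM; first exact: cst_continuous.
    apply: continuousB; last exact: cst_continuous.
    apply: continuousM; first exact: cst_continuous.
    have c1 : {for w, continuous (fun w : C => 1 - `|w| `^ (2 * b))}.
      apply: continuousB; first exact: cst_continuous.
      by apply: continuous_norm_powR; rewrite mulr_gt0.
    apply: continuousV c1.
    by rewrite subr_eq0 gt_eqF // norm_powR_lt1.
  - move=> w wr.
    have -> : radial b w = radial b m by rewrite /radial wr Km.
    rewrite /e divfK ?gt_eqF ?rad_gt0 // expRN lnK ?posrE //.
    by rewrite ler_pdivrMr // mul1r; apply: mmax; exact: mem_set.
  - move=> w w0 wr hw; have w1 : `|w| < 1 by apply: lt_trans wr r1.
    have [G [L [hL L0]]] := second_order_ln_ratio1 b0 vL w0 w1.
    have [G' hL'] := second_order_radial w0 (norm_powR_lt1 b0 w1).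
    have HD := second_orderD hL (second_orderZ e hL').
    eexists; eexists; split.
      apply: second_order_near HD.
      apply: filterS (near_norm_lt w1) => u u1.
      by rewrite lnM ?posrE ?expR_gt0 ?ratio_gt0 // expRK.
    have x0 : 0 < e * radial b w by rewrite mulr_gt0 ?rad_gt0.
    have W0 := weight_gt0 b0 w0 w1.
    have q2 := sqr_gt_of_mul_expR hw.
    rewrite -/(weight b w); have -> : e * (8 * weight b w * radial b w) =
      8 * weight b w * (e * radial b w) by ring.
    move: (weight b w) (metric_ratio b v w ^+ 2) (e * radial b w) W0 L0 q2 => W Q2 x W0 L0 q2.
    have B0 : 0 < Q2 - 1 + 2 * x by lra.
    have B1 : 0 < 4 * W * (Q2 - 1 + 2 * x) by rewrite !mulr_gt0.
    by lra.
have := key 0; rewrite normr0 => /(_ (ltW r0)).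
have -> : radial b 0 = 1.
  by rewrite /radial normr0 powR0 ?gt_eqF ?mulr_gt0 // subr0 invr1; lra.
move=> h; apply: lt_le_trans h.
by rewrite mulr1 ltr_pMr ?expR_gt1 // ratio_gt0 // normr0.
Qed.

Lemma ratio_rigidity b v z : 0 < b -> liouville_subsolution b v ->
  metric_ratio b v 0 = 1 -> z != 0 -> `|z| < 1 -> metric_ratio b v z = 1.
Proof.
move=> b0 vL q0 z0 z1; apply/eqP; rewrite eq_le ahlfors //= leNgt; apply/negP => qz.
pose d := (1 - `|z|) / 2.
have d0 : 0 < d by rewrite divr_gt0 // subr_gt0.
have zn : 0 <= `|z| by [].
pose n := Num.bound d^-1.
have nd : 1 <= n%:R * d.
  rewrite -ler_pdivrMr // div1r; apply: ltW; apply: archi_boundP.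
  by rewrite invr_ge0 ltW.
have [|||p' [p0 p1 qp]] := @ratio_lt1_inward b v d n z b0 vL d0 z0 _ _ _ qz.
- by lra.
- by rewrite /d; lra.
- by rewrite /d; lra.
have := @ratio_lt1_origin b v `|p'| b0 vL _ _ (fun w => ratio_lt1_circle b0 vL p0 p1 qp).
rewrite q0 ltxx => h; suff: false by []; apply: h; first by rewrite normr_gt0.
by apply: le_lt_trans p1 _; lra.
Qed.

Lemma nbhs_punctured_disk w : punctured_disk w -> nbhs w (@punctured_disk R).
Proof.
move=> [w0 w1].
by apply: filterS2 (near_neq0 w0) (near_norm_lt w1) => y y0 y1.
Qed.

Lemma second_order_ln_metric (lam : C -> R) z :
  conformal_pseudometric punctured_disk lam ->
  curvature_le punctured_disk lam (- 4) ->
  (forall w, punctured_disk w -> 0 < lam w) -> z != 0 -> `|z| < 1 ->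
  exists G L, second_order (fun w => ln (lam w)) z G L /\ 4 * lam z ^+ 2 <= L.
Proof.
move=> [lamc _ [_ [lamD [_ [dxD _ _]] [_ [dyD _ _]]]]] curv pos z0 z1.
have nearD : \forall w \near z, positivity_set punctured_disk lam w.
  apply: filterS2 (near_neq0 z0) (near_norm_lt z1) => w w0 w1.
  by split; [|apply: pos].
have Dz : positivity_set punctured_disk lam z := nbhs_singleton nearD.
have lamcz : {for z, continuous lam}.
  by apply: (continuous_within_open nbhs_punctured_disk lamc); case: Dz.
have lz : 0 < lam z by exact: pos.
have lam2 : second_order lam z (grad2 lam z) (laplacian lam z).
  split; [exact: lamcz| | |by []|by []].
  - split; last by have [h _] := dxD _ Dz; exact: h.
    by apply: filterS nearD => w /lamD[h _]; exact: h.
  - split; last by have [_ h] := dyD _ Dz; exact: h.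
    by apply: filterS nearD => w /lamD[_ h]; exact: h.
have lnD : \forall t \near lam z, is_derive (t : R) (1 : R) (@ln R) (t^-1).
  by apply: filterS (lt_nbhsr lz) => t; exact: is_derive1_ln.
have invD : is_derive (lam z) (1 : R) (fun t => t^-1) (- lam z ^- 2 * 1).
  exact: (@is_derive_inv _ id _ _ (lt0r_neq0 lz) (is_derive_id (lam z) (1 : R))).
have H := second_order_comp lnD invD lam2.
eexists; eexists; split; first exact: H.
have [_ _ _ _ <-] := H.
by have := curv z Dz; rewrite /gauss_curvature mulNr lerN2 ler_pdivlMr ?exprn_gt0.
Qed.

Lemma liouville_of_metric (alpha : R) (lam v : C -> R) :
  conformal_pseudometric punctured_disk lam ->
  curvature_le punctured_disk lam (- 4) ->
  {within disk, continuous v} ->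
  (forall z, punctured_disk z -> 0 < lam z /\ ln (lam z) = - alpha * ln `|z| + v z) ->
  liouville_subsolution (1 - alpha) v.
Proof.
move=> cl curv vc sing; split.
  move=> z z1; apply: (continuous_within_open _ vc) => // w w1.
  exact: near_norm_lt.
move=> z z0 z1.
have pos w : punctured_disk w -> 0 < lam w by move=> /sing[].
have [G [L [H L0]]] := second_order_ln_metric cl curv pos z0 z1.
have HD := second_orderD H (second_orderZ alpha (second_order_ln_norm z0)).
eexists; eexists; split.
  apply: second_order_near HD.
  apply: filterS2 (near_neq0 z0) (near_norm_lt z1) => w w0 w1.
  have [_ E] := sing w (conj w0 w1).
  change (ln (lam w) + alpha * ln `|w| = v w); rewrite E; ring.
rewrite mulr0 addr0; apply: le_trans L0.
have [lz E] := sing z (conj z0 z1).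
have z0' : 0 < `|z| by rewrite normr_gt0.
rewrite -[lam z]lnK ?posrE // E expRD exprMn.
have -> : expR (- alpha * ln `|z|) = `|z| `^ (- alpha) by rewrite /powR gt_eqF.
have -> : 2 * (1 - alpha - 1) = - alpha * 2%:R by ring.
by rewrite powRrM powR_mulrn ?powR_ge0 // [leRHS]mulrA.
Qed.

Lemma metric_ratioE (alpha : R) (lam v : C -> R) z : alpha < 1 ->
  z != 0 -> `|z| < 1 -> 0 < lam z -> ln (lam z) = - alpha * ln `|z| + v z ->
  lam z / lambda_ alpha z = metric_ratio (1 - alpha) v z /\ 0 < lambda_ alpha z.
Proof.
move=> a1 z0 z1 lz E.
have b0 : 0 < 1 - alpha by rewrite subr_gt0.
have z0' : 0 < `|z| by rewrite normr_gt0.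
have s1 : 0 < 1 - `|z| `^ (2 * (1 - alpha)) by rewrite subr_gt0 norm_powR_lt1.
have x0 : 0 < `|z| `^ (- alpha) by rewrite powR_gt0.
split; last by rewrite mulr_gt0 // divr_gt0.
rewrite -[lam z]lnK ?posrE // E expRD.
have -> : expR (- alpha * ln `|z|) = `|z| `^ (- alpha) by rewrite /powR gt_eqF.
rewrite /metric_ratio /lambda_.
field.
by rewrite !gt_eqF.
Qed.

End Conclusion.

Theorem theorem2p5 (R : realType) (alpha : R) (lam : Rcomplex R -> R) :
  alpha < 1 ->
  conformal_pseudometric punctured_disk lam ->
  curvature_le punctured_disk lam (- 4) ->
  conical_singularity lam alpha ->
  (exists z : nat -> Rcomplex R,
    [/\ forall n, punctured_disk (z n),
        z @ \oo --> (0 : Rcomplex R) &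
        (fun n => lam (z n) / lambda_ alpha (z n)) =
          cst 1 +o_\oo (fun n => `|z n| `^ (2 * (1 - alpha)))]) ->
  forall z, punctured_disk z -> lam z = lambda_ alpha z.
Proof.
move=> a1 cl curv [v vc sing] [z [zD z0 zo]] w [w0 w1].
have b0 : 0 < 1 - alpha by rewrite subr_gt0.
have vL := liouville_of_metric cl curv vc sing.
have ratioE y : y != 0 -> `|y| < 1 ->
    lam y / lambda_ alpha y = metric_ratio (1 - alpha) v y /\ 0 < lambda_ alpha y.
  by move=> y0 y1; have [ly E] := sing y (conj y0 y1); exact: metric_ratioE.
have q0 : metric_ratio (1 - alpha) v 0 = 1.
  have c0 : metric_ratio (1 - alpha) v (z n) @[n --> \oo] --> metric_ratio (1 - alpha) v 0.
    apply: (continuous_cvg _ _ z0); apply: continuous_ratio => //.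
    by case: vL => + _; apply; rewrite normr0.
  have c1 : metric_ratio (1 - alpha) v (z n) @[n --> \oo] --> (1 : R).
    apply/cvgrPdist_le => e e0.
    have := (iffLR (eqaddoP _ _ _ _)) zo e e0.
    apply: filterS => n; have [n0 n1] := zD n.
    rewrite /= -(ratioE _ n0 n1).1 distrC => h; apply: le_trans h _.
    apply: ler_piMr; first exact: ltW.
    by rewrite ger0_norm ?powR_ge0 // ltW // norm_powR_lt1.
  by rewrite -(cvg_lim (@Rhausdorff R) c0) (cvg_lim (@Rhausdorff R) c1).
have [E lw] := ratioE w w0 w1.
by rewrite (ratio_rigidity b0 vL q0 w0 w1) in E; rewrite -[RHS]mul1r -E divfK // gt_eqF.
Qed.
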